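(* Let $w\text{-}\sigma_0:(\bar Q,\mu_0)\to\mathbb N$ and $w\text{-}\sigma_1:(\bar Q,\mu_1)\to\mathbb N$ be two weighted persistence diagrams (over the same $Q$) with $\mu_0=\mu_1$. Then $d^{E,p}_{\mathrm{WDgm}}(w\text{-}\sigma_0,w\text{-}\sigma_1)=0$ for every $p\in[1,\infty)$.
   Context: **Intervals and Galois connections.** For a poset $Q$, $\bar Q=\{[q_1,q_2]:q_1\le q_2\}$, $\mathrm{diag}(\bar Q)=\{[q,q]:q\in Q\}$. A Galois connection $f:Q\leftrightarrows R:g$ is a pair of order-preserving maps with $f(q)\le r\iff q\le g(r)$; $\bar f([q_1,q_2])=[f(q_1),f(q_2)]$. **Displacement.** For intervals $I_i=[a_i,b_i]$, $J_i=[c_i,d_i]$ ($i=1,2$), $\mathrm{dpl}(I_1,I_2,J_1,J_2)$ is the maximum of $|(a_1-a_2)-(c_1-c_2)|$, $|(a_1-b_2)-(c_1-d_2)|$, $|(b_1-a_2)-(d_1-c_2)|$, $|(b_1-b_2)-(d_1-d_2)|$. **WDgm.** A weighted persistence diagram $w\text{-}\sigma:(\bar Q,\mu_{\bar Q})\to\mathbb N$ consists of a finite $Q\subseteq[0,\infty)$ with $0\in Q$, a function $\sigma:\bar Q\to\mathbb N$ and a probability measure $\mu_{\bar Q}$ on $\bar Q$ with $\sigma(I)>0\Rightarrow\mu_{\bar Q}(I)>0$ for $I\in\bar Q\setminus\mathrm{diag}(\bar Q)$. A morphism from $(\sigma,\mu_{\bar Q})$ to $(\tau,\mu_{\bar R})$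 is a Galois connection $f:Q\leftrightarrows R:g$ with $\tau(J)=\sum_{\bar f(I)=J}\sigma(I)$ for all $J\in\bar R\setminus\mathrm{diag}(\bar R)$ and $\bar f_\#\mu_{\bar Q}=\mu_{\bar R}$. For $p\in[1,\infty)$ its $p$-cost is $\big(\sum_{I_1,I_2\in\bar Q}\mathrm{dpl}(I_1,I_2,\bar f(I_1),\bar f(I_2))^p\mu_{\bar Q}(I_1)\mu_{\bar Q}(I_2)\big)^{1/p}$. **$p$-edit distance.** $d^{E,p}_{\mathrm{WDgm}}(A,B)$ is the infimum of the $p$-costs of all finite sequences of morphisms $A\leftrightarrow D_1\leftrightarrow\cdots\leftrightarrow D_{k-1}\leftrightarrow B$ of $\mathrm{WDgm}$ (each in either direction), the $p$-cost of a sequence being the sum of the $p$-costs of its morphisms (with $\inf\emptyset=+\infty$). *)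

(* Defs.v *)
From HB Require Import structures.
From mathcomp Require Import all_boot all_order all_algebra finmap.
From mathcomp Require Import all_classical all_reals all_analysis.
Set Implicit Arguments.
Unset Strict Implicit.
Unset Printing Implicit Defensive.
Import Order.TTheory GRing.Theory Num.Theory.
Local Open Scope ring_scope.

(* Makes a finite subset of an ordered type a finite poset for the induced
   order. *)
HB.instance Definition _ (d : Order.disp_t) (T : orderType d) (Q : {fset T}) :=
  [SubChoice_isSubOrder of Q by <: with d].

(* The set of intervals of P, in the product of P with itself; called segments
   to avoid a clash with the library's real intervals. *)
Definition segment (d : Order.disp_t) (P : finPOrderType d) :=
  {I : P * P | (I.1 <= I.2)%O}.

Definition diag (d : Order.disp_t) (P : finPOrderType d) : pred (segment P) :=
  fun I => (val I).1 == (val I).2.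

Record galois (d d' : Order.disp_t) (P : porderType d) (Q : porderType d') :=
  Galois {
    lower :> P -> Q;
    upper : Q -> P;
    lower_mono : {homo lower : x y / (x <= y)%O};
    upper_mono : {homo upper : x y / (x <= y)%O};
    lower_upper : forall x y, (lower x <= y)%O = (x <= upper y)%O
  }.

Section SegmentMap.
Variables (d d' : Order.disp_t) (P : finPOrderType d) (Q : finPOrderType d').
Variable f : galois P Q.

Lemma map_segment_subproof (I : segment P) :
  (f (val I).1 <= f (val I).2)%O.
Proof. exact/lower_mono/(valP I). Qed.

Definition map_segment (I : segment P) : segment Q :=
  exist (fun J : Q * Q => (J.1 <= J.2)%O) (f (val I).1, f (val I).2)
    (map_segment_subproof I).
End SegmentMap.

(* On a finite set (with all subsets measurable) a probability measure is given
   by its point masses. *)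
Record prob (R : realType) (T : finType) := Prob {
  mass :> {ffun T -> R};
  mass_ge0 : forall x, 0 <= mass x;
  mass_sum1 : \sum_x mass x = 1
}.

(* The finite subsets of [0, +oo) containing 0. *)
Record ground (R : realType) := Ground {
  points :> {fset R};
  points0 : 0 \in points;
  points_ge0 : forall q, q \in points -> 0 <= q
}.

Local Notation seg Q := (segment (points Q : finPOrderType _)).

Section WDgm.
Variable R : realType.

Definition ends (Q : ground R) (I : seg Q) : R * R :=
  (val (val I).1, val (val I).2).

(* The four arguments are the pairs of endpoints of the intervals. *)
Definition dpl (I1 I2 J1 J2 : R * R) : R :=
  Num.max
    (Num.max `|(I1.1 - I2.1) - (J1.1 - J2.1)| `|(I1.1 - I2.2) - (J1.1 - J2.2)|)
    (Num.max `|(I1.2 - I2.1) - (J1.2 - J2.1)| `|(I1.2 - I2.2) - (J1.2 - J2.2)|).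

Record wdgm_on (Q : ground R) := WDgmOn {
  mult : seg Q -> nat;
  weight : prob R (seg Q);
  mult_weight : forall I, ~~ diag I -> (0 < mult I)%N -> 0 < weight I
}.

Record wdgm := WDgm {
  base : ground R;
  wdgm_val :> wdgm_on base
}.

(* The two sums are over the fibre of the interval map above J; the second
   equation says that the pushforward of the measure of A is that of B. *)
Record wmor (A B : wdgm) := WMor {
  wmor_galois :> galois (points (base A)) (points (base B));
  wmor_mult : forall J : seg (base B), ~~ diag J ->
    mult B J = (\sum_(I | map_segment wmor_galois I == J) mult A I)%N;
  wmor_weight : forall J : seg (base B),
    weight B J = \sum_(I | map_segment wmor_galois I == J) weight A I
}.

Definition mor_cost (p : R) (A B : wdgm) (f : wmor A B) : R :=
  (\sum_(I1 : seg (base A)) \sum_(I2 : seg (base A))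
     dpl (ends I1) (ends I2) (ends (map_segment f I1)) (ends (map_segment f I2))
       `^ p * weight A I1 * weight A I2) `^ p^-1.

Definition edit_step (A B : wdgm) : Type := (wmor A B + wmor B A)%type.

Definition step_cost (p : R) (A B : wdgm) (s : edit_step A B) : R :=
  match s with inl f => mor_cost p f | inr g => mor_cost p g end.

Inductive edit_seq : wdgm -> wdgm -> Type :=
| EditOne A B : edit_step A B -> edit_seq A B
| EditCons A B C : edit_step A B -> edit_seq B C -> edit_seq A C.

Fixpoint edit_cost (p : R) (A B : wdgm) (s : edit_seq A B) : R :=
  match s with
  | EditOne _ _ e => step_cost p e
  | EditCons _ _ _ e s' => step_cost p e + edit_cost p s'
  end.

(* The infimum is taken in \bar R, where ereal_inf set0 = +oo. *)
Definition edit_dist (p : R) (A B : wdgm) : \bar R :=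
  ereal_inf (range (fun s : edit_seq A B => (edit_cost p s)%:E)).

End WDgm.

(* Main.v *)
Require Import Defs.
From mathcomp Require Import all_boot all_order all_algebra finmap.
From mathcomp Require Import all_classical all_reals all_analysis.
From mathcomp Require Import ring.
Import Order.TTheory GRing.Theory Num.Theory.
Local Open Scope ring_scope.

(** A morphism constrains multiplicities only off the diagonal, so multiplicity
    disappears for free once its interval is collapsed to a point. Collapsing an
    interval moves its endpoints, hence everything else with those endpoints;
    but the cost only sees mass, and a multiplicity needs just an arbitrarily
    small positive mass to accompany it. The proof separates the two.

    Let [a < c] be consecutive points of [Q] and [m] a point strictly between
    them. Over [Q] with [m] added, keep the fraction [1 - d] of the mass of each
    interval where it is, and put the remaining fraction [d], together with all
    the multiplicity, on the same interval with left endpoint [a] replaced by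
    [m] (when that is an interval). Sending [m] down to [a] gives back the
    original diagram; sending [m] up to [c] gives a diagram over [Q] again, in
    which all the multiplicity at left endpoint [a] has slid to left endpoint
    [c], or onto the diagonal. Both maps fix [Q] and so move only intervals
    carrying mass at most [d]; their costs are at most [(C * d) `^ p^-1] with
    [C] depending only on the two maps, hence as small as desired
    ([edit_within_slide]).

    The slid measure depends only on [d] and on the original measure. So two
    diagrams with equal measures, slid with the same [d], still have equal
    measures, and the slide can be iterated ([edit_within_high]): treating the
    left endpoints in increasing order, finitely many slides push all the
    multiplicity of both diagrams onto the diagonal, where the identity of [Q]
    is a morphism of cost zero between them ([edit_within_off_diag]). *)

Set Implicit Arguments.
Unset Strict Implicit.

Local Notation chain Q := (points Q : finPOrderType _).
Local Notation seg Q := (segment (points Q : finPOrderType _)).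

(** * Sums over fibres and mixtures of pushforwards *)

(** Functoriality of the pushforward, for multiplicities as well as for masses. *)
Lemma big_fibers (V : Type) (idx : V) (op : Monoid.com_law idx)
  (S T U : finType) (g : S -> T) (h : T -> U) (k : S -> U) (F : S -> V) (u : U) :
  h \o g =1 k ->
  \big[op/idx]_(t | h t == u) \big[op/idx]_(s | g s == t) F s
    = \big[op/idx]_(s | k s == u) F s.
Proof.
move=> hk; rewrite (partition_big g (fun t => h t == u)) /=; last first.
  by move=> s; rewrite -hk.
apply: eq_bigr => t /eqP <-; apply: eq_bigl => s.
by rewrite -hk /=; case: eqVneq => [->|]; rewrite ?eqxx ?andbF.
Qed.

Lemma sum_fibers (V : nmodType) (S T : finType) (g : S -> T) (F : S -> V) :
  \sum_t \sum_(s | g s == t) F s = \sum_s F s.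
Proof. by rewrite [RHS](partition_big g xpredT). Qed.

Section Probability.
Variable R : realType.

Lemma sub_mass_le1 (T : finType) (m : prob R T) (P : pred T) :
  \sum_(x | P x) m x <= 1.
Proof.
rewrite -(mass_sum1 m) [leRHS](bigID P) /= lerDl.
by apply: sumr_ge0 => x _; exact: mass_ge0.
Qed.

Lemma mass_le1 (T : finType) (m : prob R T) (x : T) : m x <= 1.
Proof. by have := sub_mass_le1 m (pred1 x); rewrite big_pred1_eq. Qed.

Variables (S T : finType) (m : prob R S) (i k : S -> T) (d : R).
Hypothesis hd : 0 < d <= 1.

Let d_ge0 : 0 <= d. Proof. by case/andP: hd => /ltW. Qed.
Let cd_ge0 : 0 <= 1 - d. Proof. by rewrite subr_ge0; case/andP: hd. Qed.

(** The convex combination, with weights [1 - d] and [d], of the pushforwards of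
    [m] along [i] and [k]. *)
Definition mix_mass : {ffun T -> R} :=
  [ffun t => (1 - d) * (\sum_(s | i s == t) m s)
             + d * (\sum_(s | k s == t) m s)].

Fact mix_mass_ge0 t : 0 <= mix_mass t.
Proof.
rewrite ffunE addr_ge0// mulr_ge0//; apply: sumr_ge0 => s _; exact: mass_ge0.
Qed.

Fact mix_mass_sum1 : \sum_t mix_mass t = 1.
Proof.
under eq_bigr do rewrite ffunE.
by rewrite big_split/= -!mulr_sumr !sum_fibers mass_sum1 !mulr1 subrK.
Qed.

Definition mix : prob R T := Prob mix_mass_ge0 mix_mass_sum1.

Lemma mixE t :
  mix t = (1 - d) * (\sum_(s | i s == t) m s) + d * (\sum_(s | k s == t) m s).
Proof. by rewrite ffunE. Qed.

(** Only the [d] part of the mixture reaches points outside the image of [i]. *)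
Lemma mix_le t : (forall s, i s != t) -> mix t <= d.
Proof.
move=> it; rewrite mixE big_pred0 => [|s]; last exact/negbTE.
by rewrite mulr0 add0r ler_piMr// sub_mass_le1.
Qed.

(** An arbitrarily small [d] is still enough to support a multiplicity carried
    along [k]. *)
Lemma mix_gt0 s : 0 < m s -> 0 < mix (k s).
Proof.
have [d0 d1] := andP hd => ms; rewrite mixE ltr_wpDl//.
  by rewrite mulr_ge0 ?subr_ge0// sumr_ge0// => *; exact: mass_ge0.
rewrite mulr_gt0// (bigD1 s)//= ltr_pwDl//.
by rewrite sumr_ge0// => *; exact: mass_ge0.
Qed.

Lemma mix_fibers (U : finType) (h : T -> U) (i' k' : S -> U) (u : U) :
  h \o i =1 i' -> h \o k =1 k' ->
  \sum_(t | h t == u) mix t =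
  (1 - d) * (\sum_(s | i' s == u) m s) + d * (\sum_(s | k' s == u) m s).
Proof.
move=> hi hk; under eq_bigr do rewrite mixE.
rewrite big_split -!mulr_sumr; congr (_ * _ + _ * _); exact: big_fibers.
Qed.

End Probability.

(** * Galois connections from a finite chain *)

Section Galois.

Fact id_lower_upper d (P : porderType d) (x y : P) : (id x <= y)%O = (x <= id y)%O.
Proof. by []. Qed.

Definition galois_id d (P : porderType d) : galois P P :=
  Galois (fun _ _ => id) (fun _ _ => id) (@id_lower_upper d P).

(** On a finite chain a monotone map preserves all nonempty joins, so fixing the
    bottom is all that it lacks to be a lower adjoint. *)
Lemma galois_of_bottom d d' (P : finOrderType d) (Q : porderType d')
    (f : P -> Q) (x0 : P) :
  {homo f : x y / (x <= y)%O} -> (forall y, (f x0 <= y)%O) ->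
  {g : galois P Q | g =1 f}.
Proof.
move=> fmono f0.
pose u y := [arg max_(x > x0 | (f x <= y)%O) x]%O.
(* the set defining the maximum is nonempty because it contains [x0] *)
have uP y : (f (u y) <= y)%O /\ (forall x, (f x <= y)%O -> (x <= u y)%O).
  rewrite /u; case: (@Order.TotalTheory.arg_maxP _ _ _ x0 (fun x => (f x <= y)%O) id).
    exact: f0.
  by move=> x ? hx; split.
have adj x y : (f x <= y)%O = (x <= u y)%O.
  apply/idP/idP => [|xu]; first exact: (uP y).2.
  exact: le_trans (fmono _ _ xu) (uP y).1.
have umono : {homo u : x y / (x <= y)%O}.
  by move=> x y xy; rewrite -adj; apply: le_trans xy; exact: (uP x).1.
by exists (Galois fmono umono adj).
Qed.

End Galois.

(** * Sliding left endpoints *)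

Section Slide.
Variables (d : Order.disp_t) (P : finPOrderType d).

Lemma val_map_segment d' (Q : finPOrderType d') (f : galois P Q) (I : segment P) :
  val (map_segment f I) = (f (val I).1, f (val I).2).
Proof. by []. Qed.

(** When [(b, _)] is not an interval, [insubd] leaves the interval where it is;
    in particular [[a, a]] does not move up. *)
Definition slide (a b : P) (I : segment P) : segment P :=
  if (val I).1 == a then insubd I (b, (val I).2) else I.

Lemma val_slide a b I :
  val (slide a b I) =
  if ((val I).1 == a) && (b <= (val I).2)%O then (b, (val I).2) else val I.
Proof. by rewrite /slide; case: ifP => //= _; rewrite val_insubd. Qed.

Lemma slide_id a : slide a a =1 id.
Proof.
move=> I; apply: val_inj; rewrite val_slide; case: ifP => // /andP[/eqP <- _].
by rewrite -surjective_pairing.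
Qed.

Lemma diag_slide a b I : (a < b)%O -> diag I -> diag (slide a b I).
Proof.
rewrite /diag val_slide => ab /eqP e; case: ifP => [/andP[/eqP Ia]|_]; last by rewrite e.
by rewrite -e Ia => /(lt_le_trans ab); rewrite ltxx.
Qed.

End Slide.

(** * Costs *)

Section Cost.
Variables (R : realType) (p : R).
Hypothesis hp : 1 <= p.

Let p_gt0 : 0 < p. Proof. exact: lt_le_trans hp. Qed.
Let p_neq0 : p != 0. Proof. exact: lt0r_neq0. Qed.

Lemma dpl_refl (x y : R * R) : dpl x y x y = 0.
Proof. by rewrite /dpl !subrr !normr0 !maxxx. Qed.

(** A bound for the cost of a morphism that does not depend on the masses, so
    that the mass to be moved can be chosen after it. *)
Definition total_dpl (Q S : ground R) (f : galois (chain Q) (chain S)) : R :=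
  \sum_(I1 : seg Q) \sum_(I2 : seg Q)
    dpl (ends I1) (ends I2) (ends (map_segment f I1)) (ends (map_segment f I2)) `^ p.

Lemma total_dpl_ge0 (Q S : ground R) (f : galois (chain Q) (chain S)) :
  0 <= total_dpl f.
Proof. by do 2![apply: sumr_ge0 => ? _]; exact: powR_ge0. Qed.

(** A pair of intervals contributes only if one of them is moved; then one of
    its two masses is at most [e] and the other at most [1]. *)
Lemma mor_cost_le (A B : wdgm R) (f : wmor A B) (e : R) :
  0 <= e ->
  (forall I, ends (map_segment f I) <> ends I -> weight A I <= e) ->
  mor_cost p f <= (total_dpl f * e) `^ p^-1.
Proof.
move=> e0 fe; rewrite /mor_cost; apply: ge0_ler_powR.
- by rewrite invr_ge0 ltW.
- rewrite nnegrE; do 2![apply: sumr_ge0 => ? _].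
  by rewrite !mulr_ge0 ?powR_ge0 ?mass_ge0.
- by rewrite nnegrE mulr_ge0 ?total_dpl_ge0.
rewrite /total_dpl mulr_suml; apply: ler_sum => I1 _.
rewrite mulr_suml; apply: ler_sum => I2 _.
rewrite -mulrA.
have [-> /=|f1] := eqVneq (ends (map_segment f I1)) (ends I1); last first.
  apply: ler_wpM2l; first exact: powR_ge0.
  rewrite -[leRHS]mulr1; apply: ler_pM; rewrite ?mass_ge0 ?mass_le1//.
  exact/fe/eqP.
have [->|f2] := eqVneq (ends (map_segment f I2)) (ends I2).
  by rewrite dpl_refl powR0// !mul0r.
apply: ler_wpM2l; first exact: powR_ge0.
rewrite -[leRHS]mul1r; apply: ler_pM; rewrite ?mass_ge0 ?mass_le1//.
exact/fe/eqP.
Qed.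

(** Solves the bound of [mor_cost_le] for the mass: the [+ 1] only avoids a
    division by zero. *)
Lemma root_le (x y d e : R) :
  0 <= x <= y -> 0 <= d <= e `^ p / (y + 1) -> 0 < e -> (x * d) `^ p^-1 <= e.
Proof.
move=> /andP[x0 xy] /andP[d0 de] e0.
have y1 : 0 < y + 1 by rewrite ltr_wpDl// (le_trans x0).
rewrite -[leRHS](powRr1 (ltW e0)) -(mulfV p_neq0) powRrM.
apply: ge0_ler_powR; rewrite ?nnegrE ?invr_ge0 ?(ltW p_gt0) ?mulr_ge0 ?powR_ge0//.
rewrite ler_pdivlMr// in de.
apply: le_trans de; rewrite mulrC ler_wpM2l//.
by rewrite (le_trans xy)// lerDl.
Qed.

(** Closeness by an actual edit sequence: unlike a bound on the infimum, it
    composes without any approximation. *)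
Definition edit_within (e : R) (A B : wdgm R) :=
  exists s : edit_seq A B, edit_cost p s <= e.

Lemma edit_within_trans e1 e2 A B C :
  edit_within e1 A B -> edit_within e2 B C -> edit_within (e1 + e2) A C.
Proof.
move=> [s se] [t te].
suff [u eu] : exists u : edit_seq A C, edit_cost p u = edit_cost p s + edit_cost p t.
  by exists u; rewrite eu lerD.
elim: s C t {se te} => [{}A {}B s|{}A {}B D s s' IH] C t.
  by exists (EditCons s t).
have [u eu] := IH _ t.
by exists (EditCons s u); rewrite /= eu addrA.
Qed.

Lemma edit_within_mor e A B (f : wmor A B) :
  mor_cost p f <= e -> edit_within e A B /\ edit_within e B A.
Proof. by move=> fe; split; [exists (EditOne (inl f))|exists (EditOne (inr f))]. Qed.

Lemma edit_cost_ge0 A B (s : edit_seq A B) : 0 <= edit_cost p s.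
Proof.
have step_ge0 C D (t : edit_step C D) : 0 <= step_cost p t.
  by case: t => f; exact: powR_ge0.
by elim: s => //= *; rewrite addr_ge0.
Qed.

Lemma edit_dist_eq0 A B : (forall e, 0 < e -> edit_within e A B) -> edit_dist p A B = 0%E.
Proof.
move=> AB; apply/eqP; rewrite eq_le; apply/andP; split.
  apply/lee_addgt0Pr => e /AB[s se].
  rewrite add0e; apply: le_trans (_ : ((edit_cost p s)%:E <= _)%E).
    by apply: ereal_inf_lbound; exists s.
  by rewrite lee_fin.
by apply: le_ereal_inf_tmp => _ [s _ <-]; rewrite lee_fin edit_cost_ge0.
Qed.

End Cost.

(** * Separating multiplicity from mass *)

Section Mixture.
Variables (R : realType) (Q : ground R) (s : wdgm_on Q) (d : R).
Hypothesis hd : 0 < d <= 1.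

Section Target.
Variables (S : ground R) (i k : seg Q -> seg S).
Hypothesis kdiag : forall I, diag I -> diag (k I).

Definition mix_mult (J : seg S) : nat := (\sum_(I | k I == J) mult s I)%N.

Lemma mix_mult_gt0 J : ~~ diag J -> (0 < mix_mult J)%N ->
  exists I, [/\ k I = J, ~~ diag I & (0 < mult s I)%N].
Proof.
rewrite /mix_mult lt0n sum_nat_eq0 => dJ.
rewrite negb_forall => /existsP[I]; rewrite negb_imply -lt0n => /andP[/eqP kI sI].
by exists I; split=> //; apply: contra dJ; rewrite -kI; exact: kdiag.
Qed.

Fact mix_mult_weight J : ~~ diag J -> (0 < mix_mult J)%N ->
  0 < mix (weight s) i k hd J.
Proof.
move=> dJ /(mix_mult_gt0 dJ)[I [<- dI sI]].
exact/mix_gt0/(mult_weight dI).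
Qed.

(** The diagram over [S] whose multiplicities all travel along [k], while only
    the fraction [d] of the mass does, the rest travelling along [i]. *)
Definition mixture : wdgm_on S := WDgmOn mix_mult_weight.

End Target.

Variables (S : ground R) (i k : seg Q -> seg S).
Hypothesis kdiag : forall I, diag I -> diag (k I).
Let D := WDgm (mixture i kdiag).

(** Pushing a mixture forward gives the mixture along the composed maps. *)
Lemma mixture_mor (T : ground R) (i' k' : seg Q -> seg T)
  (kdiag' : forall I, diag I -> diag (k' I)) (f : galois (chain S) (chain T)) :
  map_segment f \o i =1 i' -> map_segment f \o k =1 k' ->
  {g : wmor D (WDgm (mixture i' kdiag')) | wmor_galois g = f}.
Proof.
move=> fi fk; unshelve eexists; first exists f => //.
- by move=> J _; rewrite /= /mix_mult (big_fibers _ _ _ fk).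
- by move=> J; rewrite (mix_fibers _ _ _ fi fk) mixE.
- by [].
Qed.

(** If both composites are the identity, the two parts of the mass recombine
    into the original diagram. *)
Lemma mixture_retract (f : galois (chain S) (chain Q)) :
  map_segment f \o i =1 id -> map_segment f \o k =1 id ->
  {g : wmor D (WDgm s) | wmor_galois g = f}.
Proof.
move=> fi fk; unshelve eexists; first exists f => //.
- by move=> J _; rewrite /= /mix_mult (big_fibers _ _ _ fk) big_pred1_eq.
- move=> J; rewrite (mix_fibers _ _ _ fi fk).
  by rewrite !big_pred1_eq -mulrDl subrK mul1r.
- by [].
Qed.

Lemma mixture_weight_le J : (forall I, i I != J) -> weight D J <= d.
Proof. exact: mix_le. Qed.

End Mixture.

(** * Sliding multiplicity between consecutive points at small cost *)

Section Midpoint.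
Variables (R : realType) (Q : ground R) (a c : chain Q).
Hypothesis ac : (a < c)%O.
Hypothesis succ : forall x : chain Q, (a < x)%O -> (c <= x)%O.

Let m : R := (val a + val c) / 2.

Let am : val a < m.
Proof. by rewrite /m; have := midf_lt ac; case. Qed.

Let mc : m < val c.
Proof. by rewrite /m; have := midf_lt ac; case. Qed.

Let m_gap (x : chain Q) : (val x <= m -> x <= a)%O /\ (m <= val x -> c <= x)%O.
Proof.
split => xm.
  rewrite leNgt; apply/negP => /succ cx.
  by have := le_lt_trans (le_trans (cx : val c <= val x) xm) mc; rewrite ltxx.
by apply: succ; exact: lt_le_trans am xm.
Qed.

Let m_notin : m \notin points Q.
Proof.
apply/negP => mQ; have [] := m_gap (FSetSub mQ) => /(_ (lexx _)) /= h _.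
by have := lt_le_trans am h; rewrite ltxx.
Qed.

Fact refined0 : 0 \in (m |` points Q)%fset.
Proof. by rewrite in_fset1U points0 orbT. Qed.

Fact refined_ge0 q : q \in (m |` points Q)%fset -> 0 <= q.
Proof.
rewrite in_fset1U => /orP[/eqP ->|]; last exact: points_ge0.
by apply: le_trans (ltW am); exact/points_ge0/(valP a).
Qed.

(** The position of the new point between [a] and [c] is immaterial, since the
    cost is controlled by the mass moved. *)
Definition refined : ground R := Ground refined0 refined_ge0.

Let mid : chain refined := FSetSub (fset1U1 m (points Q)).
Let emb : chain Q -> chain refined := fincl (fsubsetU1 m (points Q)).

Let emb_eq x y : (emb x == emb y) = (x == y).
Proof. by rewrite -!val_eqE. Qed.

Let refinedP (y : chain refined) : y = mid \/ exists x, y = emb x.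
Proof.
have := valP y; rewrite in_fset1U => /orP[/eqP ym|yQ]; [left|right].
  exact: val_inj.
by exists (FSetSub yQ); exact: val_inj.
Qed.

(** The retraction onto [Q] sending the new point to [x]: the default value of
    [insubd] is used exactly there. *)
Let collapse (x : chain Q) (y : chain refined) : chain Q := insubd x (val y).

Let collapse_emb x y : collapse x (emb y) = y.
Proof. by apply: val_inj; rewrite /collapse val_insubd /= (valP y). Qed.

Let collapse_mid x : collapse x mid = x.
Proof. by apply: val_inj; rewrite /collapse val_insubd /= (negPf m_notin). Qed.

Let bot (S : ground R) : chain S := FSetSub (points0 S).

Let bot_le (S : ground R) (x : chain S) : (bot S <= x)%O.
Proof. exact/points_ge0/(valP x). Qed.

Let galois_emb : {g : galois (chain Q) (chain refined) | g =1 emb}.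
Proof.
apply: (@galois_of_bottom _ _ _ _ emb (bot Q)) => //.
exact: (@bot_le refined).
Qed.

Let galois_collapse x :
  (forall y : chain Q, (val y <= m -> y <= x)%O /\ (m <= val y -> x <= y)%O) ->
  {g : galois (chain refined) (chain Q) | g =1 collapse x}.
Proof.
move=> xm; apply: (@galois_of_bottom _ _ _ _ (collapse x) (bot refined)).
  move=> y z; have [->|[{}y ->]] := refinedP y;
    have [->|[{}z ->]] := refinedP z; rewrite ?collapse_emb ?collapse_mid //.
  - exact: (xm z).2.
  - exact: (xm y).1.
move=> y; suff -> : collapse x (bot refined) = bot Q by exact: bot_le.
by apply: val_inj; rewrite /collapse val_insubd /= points0.
Qed.

Let gap_a (y : chain Q) : (val y <= m -> y <= a)%O /\ (m <= val y -> a <= y)%O.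
Proof. by have [ya cy] := m_gap y; split=> // /cy; apply: le_trans; exact: ltW. Qed.

Let gap_c (y : chain Q) : (val y <= m -> y <= c)%O /\ (m <= val y -> c <= y)%O.
Proof. by have [ya cy] := m_gap y; split=> // /ya /le_trans; apply; exact: ltW. Qed.

Let iota : seg Q -> seg refined := map_segment (sval galois_emb).

Let kappa (I : seg Q) : seg refined := slide (emb a) mid (iota I).

Let val_iota I : val (iota I) = (emb (val I).1, emb (val I).2).
Proof. by rewrite val_map_segment !(svalP galois_emb). Qed.

Let ends_iota I : ends (iota I) = ends I.
Proof. by rewrite /ends val_iota. Qed.

Let kappa_diag I : diag I -> diag (kappa I).
Proof.
move=> dI; apply: diag_slide; first exact: am.
by rewrite /diag val_iota (eqP dI) /=.
Qed.

(** The two collapses, to [a] and to [c], are treated together: for [x] in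
    [{a, c}], no point of [Q] lies strictly between [x] and the new point. *)
Section Collapse.
Variable x : chain Q.
Hypothesis gap_x :
  forall y : chain Q, (val y <= m -> y <= x)%O /\ (m <= val y -> x <= y)%O.

Let f := sval (galois_collapse gap_x).
Let fE : f =1 collapse x. Proof. exact: (svalP (galois_collapse gap_x)). Qed.

Lemma collapse_iota : map_segment f \o iota =1 id.
Proof.
move=> I; apply: val_inj.
by rewrite val_map_segment val_iota /= !fE !collapse_emb -surjective_pairing.
Qed.

(** For [x = a] the slide on the right is the identity and the collapse
    recovers [Q]; for [x = c] it carries the multiplicity from [a] to [c]. *)
Lemma collapse_kappa : map_segment f \o kappa =1 slide a x.
Proof.
move=> I; apply: val_inj.
rewrite val_map_segment !val_slide val_iota /= emb_eq.
have [Ia|_] /= := eqVneq (val I).1 a; last first.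
  by rewrite !fE !collapse_emb -surjective_pairing.
have [mI|Im] := leP mid (emb (val I).2).
  by rewrite /= !fE collapse_emb collapse_mid (gap_x _).2.
rewrite /= !fE !collapse_emb -surjective_pairing.
(* [[a, y]] lies below the new point, so it was not slid; it can be slid on the
   right only if [x = y = a], which changes nothing *)
case: ifP => // xI.
have Ix : (val I).2 = x by apply/le_anti; rewrite xI (gap_x _).1 ?ltW.
have I2 : (val I).2 = a.
  apply/le_anti/andP; split; first exact: (gap_a _).1 (ltW Im).
  by rewrite -Ia; exact: valP I.
by rewrite [LHS]surjective_pairing Ia -Ix I2.
Qed.

Lemma collapse_cost (p : R) (hp : 1 <= p) (s : wdgm_on Q) (d : R)
    (hd : 0 < d <= 1) (B : wdgm_on Q)
    (g : wmor (WDgm (mixture s hd iota kappa_diag)) (WDgm B)) :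
  wmor_galois g = f -> mor_cost p g <= (total_dpl p f * d) `^ p^-1.
Proof.
move=> gf; rewrite -gf; apply: mor_cost_le => // [|I fI].
  by have [/ltW] := andP hd.
apply: mixture_weight_le => J; apply/eqP => JI; apply: fI; rewrite -JI gf.
by rewrite [map_segment _ _]collapse_iota ends_iota.
Qed.

End Collapse.

(** The constant [d] is chosen before [s]: two diagrams with the same measure
    can then be slid to diagrams with the same measure. *)
Lemma edit_within_slide (p e : R) : 1 <= p -> 0 < e ->
  exists (d : R) (hd : 0 < d <= 1), forall s : wdgm_on Q,
    let s' := mixture s hd id (fun I => diag_slide ac (I := I)) in
    edit_within p e (WDgm s) (WDgm s') /\ edit_within p e (WDgm s') (WDgm s).
Proof.
move=> hp e0.
pose f := sval (galois_collapse gap_a); pose h := sval (galois_collapse gap_c).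
pose y := total_dpl p f + total_dpl p h.
have f0 : 0 <= total_dpl p f by exact: total_dpl_ge0.
have h0 : 0 <= total_dpl p h by exact: total_dpl_ge0.
have y0 : 0 <= y by exact: addr_ge0.
have q0 : 0 < (e / 2) `^ p / (y + 1).
  by rewrite divr_gt0 ?powR_gt0 ?divr_gt0// ltr_wpDl.
(* half of [e] for each of the two collapses *)
pose d := Num.min 1 ((e / 2) `^ p / (y + 1)).
have hd : 0 < d <= 1 by rewrite lt_min ltr01 q0 ge_min lexx.
exists d, hd => s s'.
have dq : 0 <= d <= (e / 2) `^ p / (y + 1).
  by rewrite ge_min lexx orbT andbT; have [/ltW] := andP hd.
have e2 : 0 < e / 2 by rewrite divr_gt0.
have [g gf] : {g : wmor (WDgm (mixture s hd iota kappa_diag)) (WDgm s) |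
               wmor_galois g = f}.
  apply: mixture_retract; first exact: collapse_iota.
  by move=> I; rewrite collapse_kappa slide_id.
have [g' gf'] : {g : wmor (WDgm (mixture s hd iota kappa_diag)) (WDgm s') |
               wmor_galois g = h}.
  apply: mixture_mor; first exact: collapse_iota.
  exact: collapse_kappa.
have /edit_within_mor[wg wg1] : mor_cost p g <= e / 2.
  apply: le_trans (collapse_cost hp gf) _.
  by apply: (root_le hp _ dq) => //; rewrite f0 lerDl.
have /edit_within_mor[wg' wg1'] : mor_cost p g' <= e / 2.
  apply: le_trans (collapse_cost hp gf') _.
  by apply: (root_le hp _ dq) => //; rewrite h0 lerDr.
by rewrite [e]splitr; split; apply: edit_within_trans; eassumption.
Qed.

End Midpoint.

(** * Exhausting the off-diagonal multiplicity *)

Section Descent.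
Variables (R : realType) (Q : ground R).

(** The identity of [Q] is a morphism, and it moves nothing. *)
Lemma edit_within_off_diag (p e : R) (s0 s1 : wdgm_on Q) : 1 <= p -> 0 <= e ->
  weight s0 = weight s1 ->
  (forall I, ~~ diag I -> mult s0 I = mult s1 I) ->
  edit_within p e (WDgm s0) (WDgm s1).
Proof.
move=> hp e0 hw hm.
have id1 : map_segment (galois_id (chain Q)) =1 id.
  by move=> I; apply: val_inj; rewrite val_map_segment -surjective_pairing.
have hm' J : ~~ diag J -> mult s1 J =
    (\sum_(I | map_segment (galois_id (chain Q)) I == J) mult s0 I)%N.
  by move=> dJ; under eq_bigl do rewrite id1; rewrite big_pred1_eq hm.
have hw' J : weight s1 J =
    \sum_(I | map_segment (galois_id (chain Q)) I == J) weight s0 I.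
  by under eq_bigl do rewrite id1; rewrite big_pred1_eq hw.
have /edit_within_mor[] : mor_cost p (@WMor _ (WDgm s0) (WDgm s1) _ hm' hw') <= e => //.
apply: le_trans (mor_cost_le hp (lexx 0) _) _; first by [].
by rewrite mulr0 powR0// invr_neq0// gt_eqF// (lt_le_trans ltr01).
Qed.

Definition above (a : chain Q) : {set chain Q} := [set x | (a < x)%O].

Lemma above_lt (a b : chain Q) : (a < b)%O -> (#|above b| < #|above a|)%N.
Proof.
move=> ab; apply/proper_card/properP; split.
  by apply/fintype.subsetP => x; rewrite !inE; exact: lt_trans.
by exists b; rewrite !inE ?ltxx.
Qed.

Definition left_ends_high (k : nat) (s : wdgm_on Q) :=
  forall I, ~~ diag I -> (0 < mult s I)%N -> (#|above (val I).1| <= k)%N.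

(** Sliding from [a] to its successor [c] clears the lowest left endpoint that
    the hypothesis on [s] allows; intervals [[a, y]] with [a < y] have
    [c <= y], so all of them do slide. *)
Lemma left_ends_high_slide (a c : chain Q) (ac : (a < c)%O) (d : R)
    (hd : 0 < d <= 1) (k : nat) (s : wdgm_on Q) :
  #|above a| = k.+1 -> (forall x : chain Q, (a < x)%O -> (c <= x)%O) ->
  left_ends_high k.+1 s ->
  left_ends_high k (mixture s hd id (fun I => diag_slide ac (I := I))).
Proof.
move=> ak succ sk J dJ /(mix_mult_gt0 (fun I => diag_slide ac (I := I)) dJ).
move=> [I [<- dI sI]]; rewrite val_slide.
have := sk I dI sI.
case: (ltgtP (val I).1 a) => [/above_lt|aI _|Ia _] /=.
- by rewrite ak => /leq_trans h /h; rewrite ltnn.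
- by rewrite -ltnS -ak above_lt.
rewrite succ; first by rewrite -ltnS -ak above_lt.
by rewrite -Ia lt_neqAle dI; exact: valP I.
Qed.

(** Induction on the number of points above the lowest allowed left endpoint:
    each step slides both diagrams at one point, with the same [d]. For [k = 0]
    only the maximum of [Q] is an allowed left endpoint, so there is no
    multiplicity off the diagonal. *)
Lemma edit_within_high (p : R) (k : nat) (s0 s1 : wdgm_on Q) (e : R) :
  1 <= p -> 0 < e -> weight s0 = weight s1 ->
  left_ends_high k s0 -> left_ends_high k s1 ->
  edit_within p e (WDgm s0) (WDgm s1).
Proof.
move=> hp; elim: k s0 s1 e => [|k IH] s0 s1 e e0 hw h0 h1.
  apply: edit_within_off_diag => //; first exact: ltW.
  have no_mult s I : left_ends_high 0 s -> ~~ diag I -> mult s I = 0%N.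
    move=> hs dI; apply/eqP; rewrite -leqn0 leqNgt; apply/negP => /(hs I dI).
    rewrite leqn0 cards_eq0 => /eqP/setP/(_ (val I).2); rewrite !inE.
    by rewrite lt_neqAle dI (valP I).
  by move=> I dI; rewrite !no_mult.
have [/existsP[a /eqP ak]|no_a] := boolP [exists a, #|above a| == k.+1]; last first.
  have drop s : left_ends_high k.+1 s -> left_ends_high k s.
    move=> hs I dI sI; rewrite -ltnS ltn_neqAle hs// andbT.
    by move: no_a; rewrite negb_exists => /forallP.
  by apply: IH => //; exact: drop.
have /card_gt0P[c0] : (0 < #|above a|)%N by rewrite ak.
rewrite inE => ac0.
have [c ac succ] := @Order.TotalTheory.arg_minP _ _ _ c0 (fun x => (a < x)%O) id ac0.
have e3 : 0 < e / 3 by rewrite divr_gt0.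
have [d [hd slid]] := edit_within_slide ac succ hp e3.
have [w0 _] := slid s0; have [_ w1] := slid s1.
have -> : e = e / 3 + (e / 3 + e / 3) by field.
apply: edit_within_trans w0 _; apply: edit_within_trans w1.
apply: IH => //; first by rewrite /= hw.
- exact: left_ends_high_slide.
- exact: left_ends_high_slide.
Qed.

End Descent.

Theorem proposition7p2p1 (R : realType) (Q : ground R)
  (s0 s1 : wdgm_on Q) (hmu : weight s0 = weight s1)
  (p : R) (hp : 1 <= p) :
  edit_dist p (WDgm s0) (WDgm s1) = 0%E.
Proof.
apply: edit_dist_eq0 => e e0.
by apply: (@edit_within_high _ _ _ #|{: chain Q}|) => // I _ _; exact: max_card.
Qed.
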